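(* For fixed $\omega>0$, the space $P_\omega L(\mathbb{R}_+,\mathbb{L}^2(\mathbb{P},\mathbb{H}))$ of square mean $\omega$-periodic limit processes is a Banach space when equipped with the norm $$\|X\|_\infty=\sup_{t\ge0}\big(\mathbb{E}\|X(t)\|^2\big)^{1/2}=\sup_{t\ge 0}\|X(t)\|_2 .$$
   Context: $(\mathbb{H},\|\cdot\|)$ is a real separable Hilbert space, $(\Omega,\mathcal{F},\mathbb{P})$ a probability space, and $\mathbb{L}^2(\mathbb{P},\mathbb{H})$ is the Hilbert space of strongly measurable $\mathbb{H}$-valued random variables $X$ with $\mathbb{E}\|X\|^2<\infty$, with norm $\|X\|_2=(\mathbb{E}\|X\|^2)^{1/2}$. A process $X:\mathbb{R}_+\to\mathbb{L}^2(\mathbb{P},\mathbb{H})$ is continuous if $\lim_{t\to s}\mathbb{E}\|X(t)-X(s)\|^2=0$ for every $s$, and bounded if there is $K>0$ with $\mathbb{E}\|X(t)\|^2\le K$ for all $t\ge 0$. A continuous and bounded process $X$ is square mean $\omega$-periodic limit if there is a process $\tilde X:\mathbb{R}_+\to\mathbb{L}^2(\mathbb{P},\mathbb{H})$ (not necessarily continuous) with $\lim_{n\to+\infty}\mathbb{E}\|X(t+n\omega)-\tilde X(t)\|^2=0$ ($n\in\mathbb{N}$) for each $t\ge0$. $P_\omega L(\mathbb{R}_+,\mathbb{L}^2(\mathbb{P},\mathbb{H}))$ denotes the collection of all such processes $X$. *)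

(* Defs.v *)
From HB Require Import structures.
From mathcomp Require Import all_boot all_order all_algebra.
From mathcomp Require Import all_classical all_reals all_analysis.
From mathcomp Require Import measurable_realfun ring.

Set Implicit Arguments.
Unset Strict Implicit.
Unset Printing Implicit Defensive.

Import Order.TTheory GRing.Theory Num.Theory.
Import numFieldNormedType.Exports.

Local Open Scope classical_set_scope.
Local Open Scope ring_scope.

Definition is_hilbert (R : realType) (H : completeNormedModType R) : Prop :=
  exists form : {dot H for idfun}, forall x : H, `|x| ^+ 2 = form x x.

Definition separable (T : topologicalType) : Prop :=
  exists2 D : set T, countable D & dense D.

Section StronglyMeasurable.
Context d (T : measurableType d) (R : realType) (H : completeNormedModType R).
Implicit Types f g : T -> H.

Definition simple_map f : Prop :=
  finite_set (range f) /\ forall y : H, measurable (f @^-1` [set y]).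

(* The limit is required at every point, and not only almost everywhere, so
   that f is a genuine random variable even if the probability space is not
   complete. *)
Definition strongly_measurable f : Prop :=
  exists2 s : nat -> T -> H,
    forall n, simple_map (s n) & forall w, s ^~ w @ \oo --> f w.

Lemma simple_map_preimage f (B : set H) :
  simple_map f -> measurable (f @^-1` B).
Proof.
move=> [ff mf].
have -> : f @^-1` B = \bigcup_(y in range f `&` B) (f @^-1` [set y]).
  apply/seteqP; split=> [w Bw|w [y [_ By] fwy]].
    by exists (f w) => //; split=> //; exists w.
  by rewrite /preimage/= fwy.
by apply: fin_bigcup_measurable => //; exact: finite_setIl.
Qed.

Lemma simple_map_comp2 (h : H -> H -> H) f g :
  simple_map f -> simple_map g -> simple_map (fun w => h (f w) (g w)).
Proof.
move=> sf sg; split.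
  apply: (@sub_finite_set _ _ [set h x y | x in range f & y in range g]).
    by move=> _ [w _ <-]; exists (f w); [exists w|exists (g w) => //; exists w].
  by apply: finite_image2; [exact: sf.1|exact: sg.1].
move=> y.
have -> : (fun w => h (f w) (g w)) @^-1` [set y] =
    \bigcup_(x in range f) (f @^-1` [set x] `&` g @^-1` [set z | h x z = y]).
  apply/seteqP; split=> [w hy|w [x _ [/= <-]]] //.
  by exists (f w) => //; exists w.
apply: fin_bigcup_measurable; first exact: sf.1.
by move=> x _; apply: measurableI; exact: simple_map_preimage.
Qed.

Lemma strongly_measurable0 : strongly_measurable (0 : T -> H).
Proof.
exists (fun _ => 0) => [n|w]; last exact: cvg_cst.
split=> [|y].
  by apply: (@sub_finite_set _ _ [set 0]) => // _ [w _ <-].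
rewrite preimage_cst; case: ifP => _; [exact: measurableT|exact: measurable0].
Qed.

Lemma strongly_measurableZD (a : R) f g : strongly_measurable f ->
  strongly_measurable g -> strongly_measurable (a *: f + g).
Proof.
move=> [s ss sf] [u su ug].
exists (fun n w => a *: s n w + u n w) => [n|w].
  exact: (@simple_map_comp2 (fun x y => a *: x + y)).
by apply: cvgD; [exact: cvgZr|exact: ug].
Qed.

Lemma strongly_measurable_norm f : strongly_measurable f ->
  measurable_fun setT (fun w => `|f w|).
Proof.
move=> [s ss sf]; apply: (@measurable_fun_cvg _ _ _ _ (fun n w => `|s n w|)).
  move=> n _ B mB; rewrite setTI.
  exact: (@simple_map_preimage (s n) [set y | B `|y|]).
by move=> w _; apply: cvg_norm; exact: sf.
Qed.

End StronglyMeasurable.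

Section L2.
Context d (T : measurableType d) (R : realType) (P : probability T R).
Variable H : completeNormedModType R.

Definition sqmean (f : T -> H) : \bar R := 'E_P[(fun w => `|f w| ^+ 2)%R]%E.

Definition L2pred : {pred T -> H} :=
  mem [set f : T -> H | strongly_measurable f /\ (sqmean f < +oo)%E].

Lemma measurable_sqnorm (f : T -> H) : strongly_measurable f ->
  measurable_fun setT (fun w => (`|f w| ^+ 2 : R)%:E).
Proof.
move=> mf; apply/measurable_EFinP; apply: measurable_funX.
exact: strongly_measurable_norm.
Qed.

Lemma L2pred_submod_closed : submod_closed L2pred.
Proof.
split.
  rewrite inE /=; split; first exact: strongly_measurable0.
  rewrite /sqmean (_ : (fun _ => _) = cst 0) ?expectation_cst ?ltry//.
  by apply/funext => w /=; rewrite normr0 expr0n.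
move=> a f g; rewrite !inE => -[mf f2] [mg g2].
split; first exact: strongly_measurableZD.
have c0 : 0 <= 2 * `|a| ^+ 2 by rewrite mulr_ge0 ?exprn_ge0.
pose F w : \bar R := ((2 * `|a| ^+ 2)%:E * (`|f w| ^+ 2)%:E)%E.
pose G w : \bar R := (2%:E * (`|g w| ^+ 2)%:E)%E.
have F0 w : (0 <= F w)%E by rewrite mule_ge0 ?lee_fin ?exprn_ge0.
have G0 w : (0 <= G w)%E by rewrite mule_ge0 ?lee_fin ?exprn_ge0.
have mF : measurable_fun setT F.
  by apply: measurable_funeM; exact: measurable_sqnorm.
have mG : measurable_fun setT G.
  by apply: measurable_funeM; exact: measurable_sqnorm.
move: f2 g2; rewrite /sqmean unlock => f2 g2.
apply: (@le_lt_trans _ _ (\int[P]_w (F w + G w))%E).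
  apply: ge0_le_integral => //.
  - exact/measurable_sqnorm/strongly_measurableZD.
  - exact: emeasurable_funD.
  - move=> w _; rewrite /F /G -!EFinM -EFinD lee_fin.
    have : `|(a *: f + g) w| <= `|a| * `|f w| + `|g w|.
      by rewrite -normrZ; exact: ler_normD.
    set x := `|(a *: f + g) w|; set y := `|a| * _; set z := `|g w|.
    move=> xyz; have x0 : 0 <= x by exact: normr_ge0.
    rewrite -mulrA -exprMn -/y.
    apply: (@le_trans _ _ ((y + z) ^+ 2)).
      by rewrite ler_pXn2r// nnegrE (le_trans x0).
    rewrite -subr_ge0 (_ : _ - _ = (y - z) ^+ 2) ?sqr_ge0//.
    by rewrite sqrrD sqrrB; ring.
rewrite ge0_integralD//; apply: lte_add_pinfty.
  rewrite /F ge0_integralZl//; last exact: measurable_sqnorm.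
  exact: lte_mul_pinfty.
rewrite /G (@ge0_integralZl _ _ _ _ _ _ (fun w => (`|g w| ^+ 2)%:E))//.
  exact: lte_mul_pinfty.
exact: measurable_sqnorm.
Qed.

HB.instance Definition _ :=
  GRing.isSubmodClosed.Build R (T -> H) L2pred L2pred_submod_closed.

Record L2fun := MkL2fun { L2val :> T -> H ; L2valP : L2val \in L2pred }.

HB.instance Definition _ := [isSub for L2val].
HB.instance Definition _ := [Choice of L2fun by <:].
HB.instance Definition _ := [SubChoice_isSubLmodule of L2fun by <:].

Definition L2null : {pred L2fun} :=
  mem [set f : L2fun | {ae P, forall w, f w = 0}].

Lemma L2null_zmod_closed : zmod_closed L2null.
Proof.
split; first by rewrite inE /=; exact: nearW.
move=> f g; rewrite !inE /=; apply: filterS2 => w fw gw.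
by rewrite -[LHS]/(f w - g w) fw gw subr0.
Qed.

HB.instance Definition _ :=
  GRing.isZmodClosed.Build L2fun L2null L2null_zmod_closed.

Local Open Scope quotient_scope.

Definition L2 : Type := Quotient.quot L2null.

HB.instance Definition _ := GRing.Zmodule.on L2.
HB.instance Definition _ := EqQuotient.on L2.

Definition toL2 (f : L2fun) : L2 := \pi_(Quotient.quot L2null) f.
Definition ofL2 (X : L2) : L2fun := repr X.

Lemma ofL2K : cancel ofL2 toL2.
Proof. exact: reprK. Qed.

Definition L2scale (a : R) (X : L2) : L2 := toL2 (a *: ofL2 X).

Lemma toL2P (f g : L2fun) : toL2 f = toL2 g <-> {ae P, forall w, f w = g w}.
Proof.
have fgE : (toL2 f == toL2 g) = (f - g \in L2null).
  by rewrite Quotient.idealrBE.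
split=> [/eqP|fg]; last apply/eqP; rewrite fgE inE /=.
  apply: filterS => w; rewrite -[_ = 0]/(f w - g w = 0) => /eqP.
  by rewrite subr_eq0 => /eqP.
by apply: filterS fg => w fgw; rewrite -[LHS]/(f w - g w) fgw subrr.
Qed.

Lemma ofL2_ae (f : L2fun) : {ae P, forall w, ofL2 (toL2 f) w = f w}.
Proof. by apply/toL2P; rewrite ofL2K. Qed.

Lemma L2scaleE (a : R) (f : L2fun) : L2scale a (toL2 f) = toL2 (a *: f).
Proof.
apply/toL2P; apply: filterS (ofL2_ae f) => w fw.
by rewrite -[LHS]/(a *: ofL2 (toL2 f) w) fw.
Qed.

Lemma toL2D (f g : L2fun) : toL2 (f + g) = toL2 f + toL2 g.
Proof. exact: Quotient.pi_add. Qed.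

Lemma L2scaleA a b (X : L2) : L2scale a (L2scale b X) = L2scale (a * b) X.
Proof. by rewrite -(ofL2K X) (L2scaleE b) !L2scaleE scalerA. Qed.

Lemma L2scale1 : left_id 1 L2scale.
Proof. by move=> X; rewrite -[in LHS](ofL2K X) L2scaleE scale1r ofL2K. Qed.

Lemma L2scaleDr : right_distributive L2scale +%R.
Proof.
move=> a X Y; rewrite -(ofL2K X) -(ofL2K Y) -toL2D !L2scaleE -toL2D.
by rewrite scalerDr.
Qed.

Lemma L2scaleDl X : {morph L2scale^~ X : a b / a + b}.
Proof.
by move=> a b /=; rewrite -(ofL2K X) !L2scaleE -toL2D scalerDl.
Qed.

HB.instance Definition _ :=
  GRing.Zmodule_isLmodule.Build R L2 L2scaleA L2scale1 L2scaleDr L2scaleDl.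

Lemma toL2Z (a : R) (f : L2fun) : toL2 (a *: f) = a *: toL2 f.
Proof. by rewrite -L2scaleE. Qed.

Definition L2_sqmean (X : L2) : \bar R := sqmean (ofL2 X).

Lemma L2_sqmeanE (f : L2fun) : L2_sqmean (toL2 f) = sqmean f.
Proof.
rewrite /L2_sqmean /sqmean unlock; apply: ae_eq_integral => //.
- by apply: measurable_sqnorm; have /set_mem[] := L2valP (ofL2 (toL2 f)).
- by apply: measurable_sqnorm; have /set_mem[] := L2valP f.
- by apply: filterS (ofL2_ae f) => w fw _; rewrite fw.
Qed.

Definition L2norm (X : L2) : \bar R := (L2_sqmean X `^ (2^-1)%R)%E.

End L2.

HB.instance Definition _ (R : realType) := Topological.copy {nonneg R}
  (initial_topology (fun t : {nonneg R} => t%:num)).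

Section Processes.
Context d (T : measurableType d) (R : realType) (P : probability T R).
Variable H : completeNormedModType R.

Definition process : Type := {nonneg R} -> L2 P H.

HB.instance Definition _ := GRing.Lmodule.on process.

Implicit Type X : process.

Definition sqmean_continuous X : Prop :=
  forall s, L2_sqmean (X t - X s) @[t --> s] --> 0%E.

Definition sqmean_bounded X : Prop :=
  exists2 K : R, 0 < K & forall t, (L2_sqmean (X t) <= K%:E)%E.

Definition periodic_limit (omega : {posnum R}) : set process :=
  [set X | [/\ sqmean_continuous X, sqmean_bounded X &
    exists X' : process, forall t : {nonneg R},
      L2_sqmean (X (t%:num + n%:R * omega%:num)%:nng - X' t) @[n --> \oo]
        --> 0%E]].

Definition sup_norm X : \bar R := ereal_sup (range (fun t => L2norm (X t))).

End Processes.

Arguments periodic_limit {d T R} P H omega.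
Arguments sup_norm {d T R} P H X.

(* The subset A of V, with the vector space operations of V and the norm N, is
   a Banach space: it is the image of a Banach space under an injective linear
   map along which N is the norm. In particular A is a linear subspace and N
   is finite on A. *)
Definition is_banach (R : realType) (V : lmodType R) (A : set V)
    (N : V -> \bar R) : Prop :=
  exists (B : completeNormedModType R) (i : {linear B -> V}),
    [/\ injective i, range i = A & forall b : B, N (i b) = `|b|%:E].

(* Main.v *)
(* By Riesz-Fischer, L2 is complete: if |u (n+1) - u n| <= 4^-n, then the
   functions 2^n |u (n+1) - u n|^2 have a summable sequence of integrals, so
   the series of the |u (n+1) - u n| converges almost surely and u n has an
   almost sure limit in H; Fatou's lemma turns it into a limit in L2.  A
   process then belongs to the periodic limit space iff it is continuous and
   bounded and the sequence X(t + n omega) converges in L2 for every t.  Each of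
   these three conditions passes to uniform limits; for the last one this holds
   because, L2 being complete, convergence is the Cauchy property. *)

From HB Require Import structures.
Require Import Defs.
From mathcomp Require Import all_boot all_order all_algebra.
From mathcomp Require Import all_classical all_reals all_analysis.
From mathcomp Require Import measurable_realfun ring lra.

Set Implicit Arguments.
Unset Strict Implicit.
Unset Printing Implicit Defensive.

Import Order.TTheory GRing.Theory Num.Theory.
Import numFieldNormedType.Exports.

Local Open Scope classical_set_scope.
Local Open Scope ring_scope.

(** * Completeness through geometric sequences, and uniform limits *)

(** Reduces completeness, stated for filters, to rapidly converging sequences: centres of balls of
    radius [e n] that belong to the Cauchy filter form such a sequence, and its limit is the limit
    of the filter. *)
Lemma geometric_complete (R : realType) (V : normedModType R) :
  (forall u : nat -> V, (forall n, `|u n.+1 - u n| <= 4^-1 ^+ n) -> cvgn u) ->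
  forall F : set_system V, ProperFilter F -> cauchy F -> cvg F.
Proof.
move=> cV F FF /cauchyP cF.
(* Two consecutive balls meet, and [e n + e n.+1] is 5/8 of [4^-1 ^+ n]. *)
pose e n : R := 4^-1 ^+ n / 2.
have e0 n : 0 < e n by rewrite divr_gt0// exprn_gt0// invr_gt0.
have /choice[x Fx] n : exists x, F (ball x (e n)) by exact: cF.
have xS n : `|x n.+1 - x n| <= 4^-1 ^+ n.
  near F => y.
  have : ball (x n) (e n) y by near: y.
  have : ball (x n.+1) (e n.+1) y by near: y.
  rewrite -!ball_normE /ball_/= => xSy xy.
  rewrite (le_trans (ler_distD y _ _))// (distrC y).
  rewrite (le_trans (lerD (ltW xSy) (ltW xy)))// /e exprS.
  have : 0 < (4^-1 : R) ^+ n by rewrite exprn_gt0// invr_gt0.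
  by lra.
have /cvg_ex[l xl] := cV x xS.
apply/cvg_ex; exists l; apply/cvgrPdist_lt => d d0.
have e_cvg : e n @[n --> \oo] --> 0.
  rewrite -[0](mul0r (2^-1 : R)); apply: cvgM; last exact: cvg_cst.
  by apply: cvg_expr; rewrite gtr0_norm ?invr_gt0// invf_lt1// ltr1n.
have d2 : 0 < d / 2 by rewrite divr_gt0.
near \oo => n.
have enlt : e n < d / 2.
  near: n; apply: filterS ((cvgrPdist_lt _ _).1 e_cvg _ d2) => n /=.
  by rewrite sub0r normrN gtr0_norm.
have lx : `|l - x n| < d / 2 by near: n; exact: (cvgrPdist_lt _ _).1.
apply: filterS (Fx n) => y; rewrite -ball_normE /ball_/= => xy.
rewrite (le_lt_trans (ler_distD (x n) _ _))// [ltRHS](splitr d) ltrD//.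
exact: lt_trans xy enlt.
Unshelve. all: by end_near. Qed.

(** The e/3 argument along an arbitrary filter: [l] is compared with [f i] through [m] and [g i]. *)
Lemma uniform_limit_cvg (R : realType) (V : normedModType R) (I : Type)
    (F : set_system I) (FF : Filter F) (f : I -> V) (l : V) :
  (forall e, 0 < e -> exists (g : I -> V) (m : V),
    [/\ g @ F --> m, `|m - l| <= e & forall i, `|g i - f i| <= e]) ->
  f @ F --> l.
Proof.
move=> fg; apply/cvgrPdist_le => e e0.
have e3 : 0 < e / 3 by rewrite divr_gt0.
have [g [m [gm ml gf]]] := fg _ e3.
apply: filterS ((cvgrPdist_le _ _).1 gm _ e3) => i gim.
have -> : e = e / 3 + (e / 3 + e / 3) by field.
rewrite (le_trans (ler_distD m _ _))// lerD//; first by rewrite distrC.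
by rewrite (le_trans (ler_distD (g i) _ _))// lerD.
Qed.

(** * Strong measurability and pointwise limits *)

Section StrongMeasurability.
Context d (T : measurableType d) (R : realType) (H : completeNormedModType R).
Implicit Types f g : T -> H.

Lemma simple_map_cst (x : H) : simple_map (fun _ : T => x).
Proof.
split=> [|y]; first by apply: (@sub_finite_set _ _ [set x]) => // _ [w _ <-].
rewrite preimage_cst; case: ifP => _; [exact: measurableT|exact: measurable0].
Qed.

Lemma strongly_measurable_cst (x : H) : strongly_measurable (fun _ : T => x).
Proof.
by exists (fun _ _ => x) => [n|w]; [exact: simple_map_cst|exact: cvg_cst].
Qed.

Lemma simple_map_if (b : T -> bool) f g : measurable_fun setT b ->
  simple_map f -> simple_map g ->
  simple_map (fun w => if b w then f w else g w).
Proof.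
move=> mb sf sg; split=> [|y].
  apply: (@sub_finite_set _ _ (range f `|` range g)).
    by move=> _ [w _ <-]; case: ifP => _; [left|right]; exists w.
  by rewrite finite_setU; split; [exact: sf.1|exact: sg.1].
have -> : (fun w => if b w then f w else g w) @^-1` [set y] =
    (b @^-1` [set true] `&` f @^-1` [set y]) `|`
    (b @^-1` [set false] `&` g @^-1` [set y]).
  apply/seteqP; split=> w; rewrite /preimage/=.
    by case: (b w) => fgw; [left|right].
  by case: (b w) => -[] [].
by apply: measurableU; apply: measurableI; (try exact: simple_map_preimage);
  rewrite -[X in measurable X]setTI; exact: mb.
Qed.

Lemma strongly_measurable_if (b : T -> bool) f g : measurable_fun setT b ->
  strongly_measurable f -> strongly_measurable g ->
  strongly_measurable (fun w => if b w then f w else g w).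
Proof.
move=> mb [s ss sf] [u su ug].
exists (fun n w => if b w then s n w else u n w) => [n|w].
  exact: simple_map_if.
by case: (b w); [exact: sf|exact: ug].
Qed.

Lemma strongly_measurableB f g : strongly_measurable f ->
  strongly_measurable g -> strongly_measurable (fun w => f w - g w).
Proof.
move=> mf mg; have := strongly_measurableZD (-1) mg mf.
by congr strongly_measurable; apply/funext => w; rewrite scaleN1r addrC.
Qed.

Lemma strongly_measurable_dist f (x : H) : strongly_measurable f ->
  measurable_fun setT (fun w => `|f w - x|).
Proof.
move=> mf; apply/strongly_measurable_norm/strongly_measurableB => //.
exact: strongly_measurable_cst.
Qed.

Section NearestPoint.
Variables (f : T -> H) (e : nat -> H).

Fixpoint nearest_dist (n : nat) (w : T) : R :=
  if n is m.+1 then Num.min `|f w - e n| (nearest_dist m w) else `|f w - e 0|.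

(** A point closest to [f w] among [e 0], ..., [e n], the earliest one in a tie. It depends on [w]
    only through the distances from [f w] to the [e k], whose measurability makes it a simple
    map. *)
Fixpoint nearest (n : nat) (w : T) : H :=
  if n is m.+1 then
    if `|f w - e n| < nearest_dist m w then e n else nearest m w
  else e 0.

Lemma nearest_distE n w : `|f w - nearest n w| = nearest_dist n w.
Proof. by elim: n => //= n IHn; rewrite minElt; case: ifP. Qed.

Lemma nearest_dist_le n k w : (k <= n)%N -> nearest_dist n w <= `|f w - e k|.
Proof.
elim: n => [|n IHn]; first by rewrite leqn0 => /eqP ->.
rewrite leq_eqVlt ltnS => /predU1P[->/=|/IHn kn] /=; rewrite ge_min.
  by rewrite lexx.
by rewrite kn orbT.
Qed.

Hypothesis mf : forall n, measurable_fun setT (fun w => `|f w - e n|).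

Lemma measurable_nearest_dist n : measurable_fun setT (nearest_dist n).
Proof. by elim: n => //= n IHn; exact: measurable_minr. Qed.

Lemma simple_map_nearest n : simple_map (nearest n).
Proof.
elim: n => [|n IHn] /=; first exact: simple_map_cst.
apply: simple_map_if => //; last exact: simple_map_cst.
by apply: measurable_fun_ltr => //; exact: measurable_nearest_dist.
Qed.

(** Once [n] reaches the index of a point within [eps] of [f w], the minimal distance stays below
    [eps]. *)
Lemma strongly_measurable_nearest :
  (forall w eps, 0 < eps -> exists n, `|f w - e n| < eps) ->
  strongly_measurable f.
Proof.
move=> fe; exists nearest; first exact: simple_map_nearest.
move=> w; apply/cvgrPdist_lt => eps /(fe w)[k fek].
exists k => // n /= kn; rewrite nearest_distE.
exact: le_lt_trans (nearest_dist_le _ kn) fek.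
Qed.

End NearestPoint.

(* The ranges of the countably many simple maps converging to the [f_ n] form a
   countable set whose closure contains the range of [f]. *)
Lemma strongly_measurable_cvg (f_ : nat -> T -> H) f :
  (forall n, strongly_measurable (f_ n)) ->
  (forall w, f_ ^~ w @ \oo --> f w) -> strongly_measurable f.
Proof.
move=> mf_ f_f.
have /choice[s sP] n : exists s : nat -> T -> H,
    (forall m, simple_map (s m)) /\ forall w, s ^~ w @ \oo --> f_ n w.
  by have [s ss sf] := mf_ n; exists s.
pose D := \bigcup_n \bigcup_m range (s n m).
have cD : countable D.
  apply: bigcup_countable => // n _; apply: bigcup_countable => // m _.
  exact: finite_set_countable ((sP n).1 m).1.
have [e] := pcard_geP cD.
apply: (@strongly_measurable_nearest f e).
  move=> n; apply: (@measurable_fun_cvg _ _ _ _ (fun k w => `|f_ k w - e n|)).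
    by move=> k; exact: strongly_measurable_dist.
  by move=> w _; apply: cvg_norm; apply: cvgB; [exact: f_f|exact: cvg_cst].
move=> w eps eps0.
have eps2 : 0 < eps / 2 by rewrite divr_gt0.
near \oo => n; near \oo => m.
have [k _ ek] : [set e k | k in setT] (s n m w).
  by apply: surj; exists n => //; exists m => //; exists w.
exists k; rewrite ek (le_lt_trans (ler_distD (f_ n w) _ _))//.
rewrite [ltRHS](splitr eps) ltrD//.
  by near: n; exact: (cvgrPdist_lt _ _).1 (f_f w) _ eps2.
by near: m; exact: (cvgrPdist_lt _ _).1 ((sP n).2 w) _ eps2.
Unshelve. all: by end_near. Qed.

End StrongMeasurability.

(** * The normed space L2 *)

Section L2NormedModule.
Context d (T : measurableType d) (R : realType) (P : probability T R).
Variable H : completeNormedModType R.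
Implicit Types (f g : T -> H) (X Y : L2 P H).

Lemma L2fun_measurable (f : L2fun P H) : strongly_measurable f.
Proof. by have /set_mem[] := L2valP f. Qed.

Lemma sqmeanE f : sqmean P f = (\int[P]_w (`|f w| ^+ 2)%:E)%E.
Proof. by rewrite /sqmean unlock. Qed.

Lemma sqmean_ge0 f : (0 <= sqmean P f)%E.
Proof. by rewrite sqmeanE; apply: integral_ge0 => w _; rewrite lee_fin. Qed.

Lemma sqmeanZ (a : R) f : strongly_measurable f ->
  sqmean P (a *: f) = ((`|a| ^+ 2)%:E * sqmean P f)%E.
Proof.
move=> mf; rewrite !sqmeanE -ge0_integralZl_EFin//; last first.
  exact: measurable_sqnorm.
apply: eq_integral => w _.
by rewrite -[(a *: f) w]/(a *: f w) normrZ exprMn EFinM.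
Qed.

Lemma sqmean_sqrt_Lnorm f :
  (sqmean P f `^ (2^-1)%R = 'N[P]_2%:E[EFin \o (fun w => `|f w|)%R])%E.
Proof.
rewrite sqmeanE unlock; congr (_ `^ _)%E; apply: eq_integral => w _ /=.
by rewrite powR_mulrn// normr_id.
Qed.

(** Minkowski's inequality for the real functions given by the pointwise norms, preceded by the
    triangle inequality in [H]. *)
Lemma sqmean_sqrtD f g : strongly_measurable f -> strongly_measurable g ->
  (sqmean P (f + g)%R `^ (2^-1)%R <=
   sqmean P f `^ (2^-1)%R + sqmean P g `^ (2^-1)%R)%E.
Proof.
move=> mf mg; have mfg : strongly_measurable (f + g).
  by rewrite -[f]scale1r; exact: strongly_measurableZD.
have [nf ng] := (strongly_measurable_norm mf, strongly_measurable_norm mg).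
rewrite (sqmean_sqrt_Lnorm f) (sqmean_sqrt_Lnorm g).
have p1 : 1 <= 2 :> R by rewrite ler1n.
apply: le_trans (minkowski_EFin P nf ng p1); rewrite unlock.
apply: gt0_ler_poweR.
- by rewrite invr_ge0.
- by rewrite in_itv/= leey sqmean_ge0.
- rewrite in_itv/= leey andbT; apply: integral_ge0 => w _ /=.
  by rewrite lee_fin powR_ge0.
rewrite sqmeanE; apply: ge0_le_integral => //.
- exact: measurable_sqnorm.
- apply: (measurableT_comp (measurable_poweR _)).
  by apply: measurableT_comp => //; apply/measurable_EFinP/measurable_funD.
move=> w _; rewrite /= powR_mulrn// lee_fin ler_pXn2r// ?nnegrE//.
by rewrite [leRHS]ger0_norm ?addr_ge0//; exact: ler_normD.
Qed.

Lemma L2_sqmean_fin X : L2_sqmean X \is a fin_num.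
Proof.
rewrite ge0_fin_numE ?sqmean_ge0//.
by have /set_mem[] := L2valP (ofL2 X).
Qed.

Definition L2_rnorm X : R := Num.sqrt (fine (L2_sqmean X)).

Lemma L2normE X : L2norm X = (L2_rnorm X)%:E.
Proof.
rewrite /L2norm poweR12_sqrt ?sqmean_ge0//.
by rewrite -[L2_sqmean X in LHS]fineK ?L2_sqmean_fin.
Qed.

Lemma L2_sqmean_rnorm X : L2_sqmean X = (L2_rnorm X ^+ 2)%:E.
Proof.
by rewrite sqr_sqrtr ?fineK ?L2_sqmean_fin// fine_ge0// sqmean_ge0.
Qed.

Lemma L2_rnormZ (a : R) X : L2_rnorm (a *: X) = `|a| * L2_rnorm X.
Proof.
rewrite /L2_rnorm -{1}(ofL2K X) -toL2Z L2_sqmeanE.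
rewrite -[sqmean _ _]/(sqmean P (a *: (ofL2 X : T -> H))).
rewrite sqmeanZ; last exact: L2fun_measurable.
rewrite fineM ?L2_sqmean_fin//= sqrtrM ?sqr_ge0//.
by rewrite sqrtr_sqr normr_id.
Qed.

Lemma L2_rnormD X Y : L2_rnorm (X + Y) <= L2_rnorm X + L2_rnorm Y.
Proof.
rewrite -lee_fin EFinD -!L2normE.
have -> : L2norm (X + Y) =
    (sqmean P ((ofL2 X : T -> H) + (ofL2 Y : T -> H))%R `^ (2^-1)%R)%E.
  by rewrite /L2norm -{1}(ofL2K X) -{1}(ofL2K Y) -toL2D L2_sqmeanE.
by apply: sqmean_sqrtD; exact: L2fun_measurable.
Qed.

(** A nonnegative function with zero integral vanishes almost everywhere, and L2 identifies
    functions that are equal almost everywhere. *)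
Lemma L2_rnorm_eq0 X : L2_rnorm X = 0 -> X = 0.
Proof.
move=> X0; have := L2_sqmean_rnorm X.
rewrite X0 expr0n /L2_sqmean sqmeanE => int0.
have msq := measurable_sqnorm (L2fun_measurable (ofL2 X)).
have /(ae_eq_integral_abs P measurableT msq) aeX :
    (\int[P]_w `|(`|ofL2 X w| ^+ 2)%:E| = 0)%E.
  by rewrite -[RHS]int0; apply: eq_integral => w _; rewrite gee0_abs ?lee_fin.
(* [0] becomes the class of an explicit representative, the zero multiple of [ofL2 X], so that
   [toL2P] applies. *)
rewrite -(ofL2K X) -[RHS](scale0r (toL2 (ofL2 X))) -toL2Z.
apply/toL2P; apply: filterS aeX => w /(_ I)[] /eqP.
rewrite sqrf_eq0 normr_eq0 => /eqP ->.
by rewrite -[RHS]/(0 *: ofL2 X w) scale0r.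
Qed.

HB.instance Definition _ := @Lmodule_isNormed.Build R (L2 P H) L2_rnorm
  L2_rnormD L2_rnormZ L2_rnorm_eq0.

Lemma L2_sqmean_norm X : L2_sqmean X = (`|X| ^+ 2)%:E.
Proof. exact: L2_sqmean_rnorm. Qed.

Lemma L2norm_norm X : L2norm X = `|X|%:E.
Proof. exact: L2normE. Qed.

Lemma sqmean_toL2B (f : L2fun P H) (Y : L2 P H) :
  sqmean P (fun w => f w - ofL2 Y w) = (`|toL2 f - Y| ^+ 2)%:E.
Proof.
rewrite -L2_sqmean_norm -[in RHS](ofL2K Y).
by rewrite -scaleN1r -toL2Z -toL2D L2_sqmeanE scaleN1r.
Qed.

Lemma sqmean_ofL2B X Y :
  sqmean P (fun w => ofL2 X w - ofL2 Y w) = (`|X - Y| ^+ 2)%:E.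
Proof. by rewrite sqmean_toL2B ofL2K. Qed.

(** Translates the convergences of mean squares in the definitions into convergences in the norm of
    L2, and back. *)
Lemma L2_sqmean_cvg0 (I : Type) (F : set_system I) (FF : Filter F)
    (u : I -> L2 P H) (l : L2 P H) :
  (L2_sqmean (u i - l) @[i --> F] --> 0%E) <-> (u @ F --> l).
Proof.
under eq_cvg do rewrite L2_sqmean_norm.
split=> [/fine_cvg/= u0|ul].
  apply/cvgrPdist_lt => e e0; have e2 : 0 < e ^+ 2 by rewrite exprn_gt0.
  move/cvgrPdist_lt : u0 => /(_ _ e2); apply: filterS => i.
  rewrite sub0r normrN ger0_norm ?exprn_ge0//.
  by rewrite distrC ltr_pXn2r ?nnegrE ?(ltW e0).
have : `|u i - l| ^+ 2 @[i --> F] --> `|l - l| ^+ 2.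
  have ull : u i - l @[i --> F] --> l - l by apply: cvgB => //; exact: cvg_cst.
  exact: (cvg_comp _ _ (cvg_norm ull) (@exprn_continuous _ 2 _)).
rewrite subrr normr0 expr0n/= => u0.
by apply: (@cvg_EFin _ _ _ _ _ (0 : R)) => //; exact: nearW.
Qed.

End L2NormedModule.

Arguments L2_sqmean_cvg0 {d T R P H I F} FF u l.

(** * The Riesz-Fischer theorem *)

Section RieszFischer.
Context d (T : measurableType d) (R : realType) (P : probability T R).
Variable H : completeNormedModType R.

(** By Fatou's lemma: almost everywhere, the squared norm of [f w] is the lower limit of those of
    the [f_ n w]. *)
Lemma sqmean_fatou (f_ : nat -> T -> H) (f : T -> H) (c : \bar R) :
  (forall n, strongly_measurable (f_ n)) -> strongly_measurable f ->
  {ae P, forall w, f_ ^~ w @ \oo --> f w} ->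
  (forall n, (sqmean P (f_ n) <= c)%E) -> (sqmean P f <= c)%E.
Proof.
move=> mf_ mf f_f f_c.
pose q n w : \bar R := (`|f_ n w| ^+ 2)%:E.
have mq n : measurable_fun setT (q n) by exact: measurable_sqnorm.
have -> : sqmean P f = (\int[P]_w limn_einf (q^~ w))%E.
  rewrite sqmeanE; apply: ae_eq_integral => //.
  - exact: measurable_sqnorm.
  (* Measurability of the lower limit follows from that of the upper limit of the [- q n]. *)
  - apply: (eq_measurable_fun (fun w => - limn_esup (fun n => - q n w)))%E.
      by move=> w _; rewrite -[RHS]oppeK -limn_esupN.
    apply/measurableT_comp => //; apply: measurable_fun_limn_esup => n.
    exact: measurableT_comp.
  apply: filterS f_f => w fw _; apply/esym.
  have : q^~ w @ \oo --> (`|f w| ^+ 2)%:E.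
    apply: cvg_EFin; first exact: nearW.
    exact: (cvg_comp _ _ (cvg_norm fw) (@exprn_continuous _ 2 _)).
  by move=> /cvg_limn_einf_sup[].
apply: le_trans (fatou P measurableT mq _) _.
  by move=> n w _; rewrite lee_fin.
(* The lower limit is the limit of the tail infima, each at most the first term of its tail, hence
   at most [c]. *)
rewrite limn_einf_lim; apply: lime_le.
  exact: is_cvg_einfs.
apply: nearW => n; apply: le_trans (f_c n).
by rewrite sqmeanE; apply: ereal_inf_lbound; exists n => /=.
Qed.

(* Either [a n <= 2^-n] or [a n <= 2^n * a n ^+ 2]. *)
Lemma weighted_square_cvg (a : nat -> R) :
  (forall n, 0 <= a n) -> cvgn (series (fun n => 2 ^+ n * a n ^+ 2)) ->
  cvgn (series a).
Proof.
move=> a0 cva.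
apply: (@series_le_cvg _ _ (fun n => 2^-1 ^+ n + 2 ^+ n * a n ^+ 2)) => //.
- by move=> n; rewrite addr_ge0// ?mulr_ge0// ?exprn_ge0.
- move=> n; have x0 : 0 < 2 ^+ n :> R by rewrite exprn_gt0.
  rewrite exprVn; set x := 2 ^+ n in x0 *.
  have [xa|xa] := leP (a n) x^-1.
    by rewrite (le_trans xa)// lerDl mulr_ge0 ?exprn_ge0// ltW.
  have : 1 <= x * a n by rewrite mulrC -ler_pdivrMr// div1r ltW.
  rewrite expr2 mulrA => /(ler_wpM2r (a0 n)); rewrite mul1r => /le_trans; apply.
  by rewrite lerDr invr_ge0 ltW.
apply: is_cvg_seriesD => //.
rewrite -[X in series X]/(GRing.exp (2^-1 : R)) exprn_geometric.
apply: is_cvg_geometric_series.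
by rewrite gtr0_norm ?invr_gt0// invf_lt1// ltr1n.
Qed.

Lemma nneseries_fin_cvg (a : nat -> R) : (forall n, 0 <= a n) ->
  (\sum_(n <oo) (a n)%:E)%E \is a fin_num -> cvgn (series a).
Proof.
move=> a0 fa; apply: nondecreasing_is_cvgn.
  exact: nondecreasing_series.
exists (fine (\sum_(n <oo) (a n)%:E)%E) => _ [n _ <-].
rewrite -lee_fin fineK// /series/= -sumEFin.
by apply: nneseries_lim_ge => k _ _; rewrite lee_fin.
Qed.

(** Even with the weight [2 ^+ n], the integrals are bounded by [8^-1 ^+ n]; so the sum of the [q n]
    is integrable and thus almost everywhere finite, which makes the norms of the increments
    summable there. *)
Lemma L2_geometric_ae_cvg (u : nat -> L2 P H) :
  (forall n, `|u n.+1 - u n| <= 4^-1 ^+ n) ->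
  {ae P, forall w, cvgn (fun n => ofL2 (u n) w)}.
Proof.
move=> u4.
pose D n w := ofL2 (u n.+1) w - ofL2 (u n) w.
pose q n w := 2 ^+ n * `|D n w| ^+ 2.
have q0 n w : 0 <= q n w by rewrite mulr_ge0 ?exprn_ge0.
have mD n : strongly_measurable (D n).
  by apply: strongly_measurableB; exact: L2fun_measurable.
have mq n : measurable_fun setT (fun w => (q n w)%:E).
  apply/measurable_EFinP; apply: measurable_funM => //.
  exact/measurable_EFinP/measurable_sqnorm.
have intq n : (\int[P]_w (q n w)%:E <= (8^-1 ^+ n)%:E)%E.
  rewrite /q; under eq_integral do rewrite EFinM.
  rewrite ge0_integralZl_EFin//; last exact: measurable_sqnorm.
  rewrite -sqmeanE sqmean_ofL2B -EFinM lee_fin.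
  have -> : 8^-1 ^+ n = 2 ^+ n * (4^-1 ^+ n) ^+ 2 :> R.
    by rewrite -exprM muln2 -addnn exprD -!exprMn; congr (_ ^+ _); field.
  by rewrite ler_pM2l ?exprn_gt0// ler_pXn2r ?nnegrE// ?exprn_ge0// invr_ge0.
have : P.-integrable setT (fun w => \sum_(n <oo) (q n w)%:E)%E.
  apply/integrableP; split.
    apply: (@ge0_emeasurable_sum _ _ _ _ (fun n w => (q n w)%:E) predT) => //.
    by move=> n w _ _; rewrite lee_fin.
  under eq_integral => w _.
    rewrite gee0_abs; last by apply: nneseries_ge0 => n _ _; rewrite lee_fin.
    over.
  rewrite integral_nneseries//; last by move=> n w _; rewrite lee_fin.
  (* The bound is the sum of the geometric series of ratio 1/8. *)
  apply: (@le_lt_trans _ _ ((1 / (1 - 8^-1))%:E)); last exact: ltry.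
  apply: lime_le.
    apply: is_cvg_nneseries => n _ _; apply: integral_ge0 => w _.
    by rewrite lee_fin.
  apply: nearW => n; apply: (@le_trans _ _ (series (geometric 1 8^-1) n)%:E).
    rewrite /series/= -sumEFin; apply: lee_sum => k _.
    by rewrite mul1r.
  rewrite lee_fin; apply: geometric_le_lim => //.
  by rewrite gtr0_norm ?invr_gt0// invf_lt1// ltr1n.
move=> /(integrable_ae measurableT); apply: filterS => w /(_ I) finq.
(* Since [H] is complete, an absolutely convergent series converges; here it telescopes to
   [u n - u 0] at [w]. *)
have : cvgn (series (telescope (fun n => ofL2 (u n) w))).
  apply: normed_cvg; apply: weighted_square_cvg => [n|]; first exact: normr_ge0.
  exact: nneseries_fin_cvg (q0^~ w) finq.
rewrite telescopeK => cuw.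
have -> : (fun n => ofL2 (u n) w) =
    (fun n => ofL2 (u n) w - ofL2 (u 0) w + ofL2 (u 0) w).
  by apply/funext => n; rewrite subrK.
by apply: is_cvgD => //; exact: is_cvg_cst.
Qed.

(** The constant 2 passes the induction, since [2 / 4 + 1 <= 2]; the step on [k] uses the induction
    hypothesis at [n.+1]. *)
Lemma geometric_dist_le (V : normedModType R) (u : nat -> V) :
  (forall n, `|u n.+1 - u n| <= 4^-1 ^+ n) ->
  forall k n, `|u (k + n)%N - u n| <= 2 * 4^-1 ^+ n.
Proof.
move=> u4; elim=> [|k IHk] n.
  by rewrite add0n subrr normr0 mulr_ge0 ?exprn_ge0 ?invr_ge0.
rewrite addSnnS (le_trans (ler_distD (u n.+1) _ _))//.
rewrite (le_trans (lerD (IHk n.+1) (u4 n)))// exprS.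
have : 0 < (4^-1 : R) ^+ n by rewrite exprn_gt0// invr_gt0.
by lra.
Qed.

Lemma L2_geometric_cvg (u : nat -> L2 P H) :
  (forall n, `|u n.+1 - u n| <= 4^-1 ^+ n) -> cvgn u.
Proof.
move=> u4; have [A [mA PA0 NA]] := L2_geometric_ae_cvg u4.
(* Set to 0 on the exceptional null set [A], the representatives converge at every point, as
   [strongly_measurable_cvg] requires. *)
pose f n w := if w \in A then 0 else ofL2 (u n) w.
pose g w := limn (f^~ w).
have mf n : strongly_measurable (f n).
  apply: strongly_measurable_if; last exact: L2fun_measurable.
    apply: (measurable_fun_bool true); rewrite setTI.
    congr measurable: mA; apply/seteqP.
    by split=> w; [exact: mem_set|exact: set_mem].
  exact: strongly_measurable0.
have f_g w : f^~ w @ \oo --> g w.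
  rewrite /g /f; case: (boolP (w \in A)) => [_|]; first exact: is_cvg_cst.
  by rewrite notin_setE => wA; apply: contra_notP wA; exact: NA.
have mg : strongly_measurable g by exact: strongly_measurable_cvg f_g.
have u_g : {ae P, forall w, ofL2 (u n) w @[n --> \oo] --> g w}.
  exists A; split=> // w /=; apply: contra_notP => wA.
  by have := f_g w; rewrite /f memNset.
(* Fatou's lemma as [k] grows, the bound on [u (k + n) - u n] being uniform in [k]. *)
have g_u n : (sqmean P (fun w => g w - ofL2 (u n) w)%R <=
    ((2 * 4^-1 ^+ n) ^+ 2)%:E)%E.
  apply: (@sqmean_fatou (fun k w => ofL2 (u (k + n)%N) w - ofL2 (u n) w)).
  - by move=> k; apply: strongly_measurableB; exact: L2fun_measurable.
  - by apply: strongly_measurableB => //; exact: L2fun_measurable.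
  - apply: filterS u_g => w; rewrite -(cvg_shiftn n) => ugw.
    by apply: cvgB => //; exact: cvg_cst.
  move=> k; rewrite sqmean_ofL2B lee_fin ler_pXn2r ?nnegrE//.
  exact: geometric_dist_le.
(* The bound at [n = 0] shows that [g] differs from [ofL2 (u 0)] by a square integrable map. *)
have gL2 : g \in @L2pred _ _ _ P H.
  have -> : g = (fun w => g w - ofL2 (u 0) w) + ofL2 (u 0).
    by apply/funext => w; rewrite -[RHS]/(_ - _ + _) subrK.
  apply: rpredD; last exact: L2valP.
  rewrite inE; split; last by rewrite (le_lt_trans (g_u 0))// ltry.
  by apply: strongly_measurableB => //; exact: L2fun_measurable.
apply/cvg_ex; exists (toL2 (MkL2fun gL2)).
apply/cvgrPdist_lt => e e0.
have : geometric 2 4^-1 @ \oo --> (0 : R).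
  by apply: cvg_geometric; rewrite gtr0_norm ?invr_gt0// invf_lt1// ltr1n.
move=> /cvgrPdist_lt/(_ _ e0); apply: filterS => n /=.
rewrite sub0r normrN ger0_norm ?mulr_ge0 ?exprn_ge0 ?invr_ge0//.
apply: le_lt_trans; move: (g_u n).
by rewrite (sqmean_toL2B (MkL2fun gL2)) lee_fin ler_pXn2r ?nnegrE.
Qed.

HB.instance Definition _ := Uniform_isComplete.Build (L2 P H)
  (geometric_complete L2_geometric_cvg).

End RieszFischer.

(* The Banach space of periodic limit processes *)
Identity Coercion process_Funclass : process >-> Funclass.

Section PeriodicLimitSpace.
Context d (T : measurableType d) (R : realType) (P : probability T R).
Variables (H : completeNormedModType R) (omega : {posnum R}).
Implicit Type X : process P H.

(** The norm of L2 replaces mean squares, and the process [X'] disappears: it can be taken to be the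
    limit, time by time, of the shifted values. *)
Lemma periodic_limitP X : periodic_limit P H omega X <->
  [/\ forall s, X @ s --> X s, exists K, forall t, `|X t| <= K &
    forall t : {nonneg R},
      cvgn (fun n : nat => X (t%:num + n%:R * omega%:num)%:nng)].
Proof.
split=> [[cX [K K0 bX] [X' XX']]|[cX [K bX] pX]].
  split=> [s||t]; first exact: (L2_sqmean_cvg0 _ X (X s)).1 (cX s).
    exists (Num.sqrt K) => t.
    rewrite -[leLHS]ger0_norm// -sqrtr_sqr ler_wsqrtr//.
    by rewrite -lee_fin -L2_sqmean_norm.
  by apply/cvg_ex; exists (X' t); exact/L2_sqmean_cvg0/XX'.
split=> [s||]; first exact: (L2_sqmean_cvg0 _ X (X s)).2 (cX s).
  (* Adding 1 makes the bound positive even if [K = 0]. *)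
  exists (K ^+ 2 + 1) => [|t]; first by rewrite ltr_wpDl ?sqr_ge0.
  rewrite L2_sqmean_norm lee_fin ler_wpDr// ler_pXn2r ?nnegrE//.
  exact: le_trans (bX t).
exists (fun t : {nonneg R} =>
  limn (fun n : nat => X (t%:num + n%:R * omega%:num)%:nng)) => t.
exact/L2_sqmean_cvg0/pX.
Qed.

Definition plimit_pred : {pred process P H} := mem (periodic_limit P H omega).

Lemma plimit_submod_closed : submod_closed plimit_pred.
Proof.
split=> [|a X Y]; rewrite !inE.
  apply/periodic_limitP; split=> [s||t].
  - exact: (@cvg_cst _ (0 : L2 P H) _ (nbhs s)).
  - by exists 0 => t; rewrite normr0.
  - exact: is_cvg_cst.
move=> /periodic_limitP[cX [K bX] pX] /periodic_limitP[cY [L bY] pY].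
apply/periodic_limitP; split=> [s||t].
- exact: (cvgD (cvgZ (cvg_cst a) (cX s)) (cY s)).
- exists (`|a| * K + L) => t.
  by rewrite (le_trans (ler_normD _ _))// lerD// normrZ ler_wpM2l.
- exact: (is_cvgD (is_cvgZ (is_cvg_cst a) (pX t)) (pY t)).
Qed.

HB.instance Definition _ := GRing.isSubmodClosed.Build R (process P H)
  plimit_pred plimit_submod_closed.

(** This subtype is the Banach space demanded by [is_banach], and its projection is the
    embedding. *)
Record plimit := MkPlimit
  { plimit_val :> process P H ; plimit_valP : plimit_val \in plimit_pred }.

HB.instance Definition _ := [isSub for plimit_val].
HB.instance Definition _ := [Choice of plimit by <:].
HB.instance Definition _ := [SubChoice_isSubLmodule of plimit by <:].

Lemma plimitP (X : plimit) : [/\ forall s, X t @[t --> s] --> X s,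
  exists K, forall t, `|X t| <= K & forall t : {nonneg R},
    cvgn (fun n : nat => X (t%:num + n%:R * omega%:num)%:nng)].
Proof. by apply/periodic_limitP; have /set_mem := plimit_valP X. Qed.

Definition plimit_norm (X : plimit) : R := fine (sup_norm P H X).

Lemma sup_norm_plimit (X : plimit) : sup_norm P H X = (plimit_norm X)%:E.
Proof.
have [_ [K bX] _] := plimitP X.
rewrite fineK// fin_numE; apply/andP; split.
  rewrite gt_eqF// (@lt_le_trans _ _ (L2norm (X 0%:nng)))//.
    by rewrite L2norm_norm ltNyr.
  by apply: ereal_sup_ubound; exists 0%:nng.
rewrite lt_eqF// (@le_lt_trans _ _ K%:E) ?ltry//.
by apply: ge_ereal_sup => _ [t _ <-]; rewrite L2norm_norm lee_fin.
Qed.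

(** The least upper bound property, from which the norm axioms and the uniform estimates are
    derived. *)
Lemma plimit_norm_le (X : plimit) (c : R) :
  plimit_norm X <= c <-> forall t, `|X t| <= c.
Proof.
rewrite -lee_fin -sup_norm_plimit; split=> [Xc t|Xc].
  rewrite -lee_fin -L2norm_norm; apply: le_trans Xc.
  by apply: ereal_sup_ubound; exists t.
by apply: ge_ereal_sup => _ [t _ <-]; rewrite L2norm_norm lee_fin.
Qed.

Lemma le_plimit_norm (X : plimit) t : `|X t| <= plimit_norm X.
Proof. by move: t; apply/plimit_norm_le. Qed.

Lemma plimit_normD (X Y : plimit) :
  plimit_norm (X + Y) <= plimit_norm X + plimit_norm Y.
Proof.
apply/plimit_norm_le => t; rewrite (le_trans (ler_normD _ _))//.
by apply: lerD; exact: le_plimit_norm.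
Qed.

Lemma plimit_norm0_eq0 (X : plimit) : plimit_norm X = 0 -> X = 0.
Proof.
move=> X0; apply/val_inj/funext => t; apply/eqP.
by rewrite -normr_le0 -X0 le_plimit_norm.
Qed.

(** The inequality [leZ] suffices: applied to [a^-1] and [a *: X], it gives the reverse one when [a]
    is nonzero. *)
Lemma plimit_normZ (a : R) (X : plimit) :
  plimit_norm (a *: X) = `|a| * plimit_norm X.
Proof.
have leZ b (Y : plimit) : plimit_norm (b *: Y) <= `|b| * plimit_norm Y.
  apply/plimit_norm_le => t.
  rewrite -[plimit_val _ t]/(b *: Y t) normrZ.
  by rewrite ler_wpM2l// le_plimit_norm.
apply/eqP; rewrite eq_le leZ/=.
have [->|a0] := eqVneq a 0.
  by rewrite normr0 mul0r (le_trans (normr_ge0 _) (le_plimit_norm _ 0%:nng)).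
rewrite -ler_pdivlMl ?normr_gt0// -normfV.
by rewrite -{1}[X]scale1r -(mulVf a0) -scalerA.
Qed.

HB.instance Definition _ := @Lmodule_isNormed.Build R plimit plimit_norm
  plimit_normD plimit_normZ plimit_norm0_eq0.

Lemma plimit_complete (F : set_system plimit) :
  ProperFilter F -> cauchy F -> cvg F.
Proof.
move=> FF /cauchyP cF.
(* One [Y] serves all times at once: Cauchy in the supremum norm means uniformly Cauchy in time. *)
have nearF e : 0 < e -> exists Y : plimit,
    \forall X \near F, forall t, `|Y t - plimit_val X t| < e.
  move=> /cF[Y FY]; exists Y; apply: filterS FY => X.
  rewrite -ball_normE /ball_/= => YX t.
  exact: le_lt_trans (le_plimit_norm (Y - X) t) YX.
have cvgF t : cvg ((fun X : plimit => X t) @ F).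
  apply: cauchy_cvg; apply: cauchy_exP => e /nearF[Y FY].
  by exists (Y t); apply: filterS FY => X; rewrite -ball_normE; apply.
pose L : process P H := fun t => lim ((fun X : plimit => X t) @ F).
have unifL e : 0 < e ->
    \forall X \near F, forall t, `|plimit_val X t - L t| <= e.
  move=> e0; have e3 : 0 < e / 3 by rewrite divr_gt0.
  have [Y FY] := nearF _ e3; apply: filterS (FY) => X YX t.
  (* [Z] may depend on [t], but [X] is only asked to be close to [Y], so the estimate is uniform in
     [t]. *)
  have [Z [YZ ZL]] :=
    filter_ex (filterI FY ((cvgrPdist_lt _ _).1 (cvgF t) _ e3)).
  have -> : e = e / 3 + (e / 3 + e / 3) by field.
  rewrite (le_trans (ler_distD (Y t) _ _))// lerD//.
    by rewrite distrC ltW.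
  rewrite (le_trans (ler_distD (Z t) _ _))// lerD// ltW// distrC.
  exact: ZL.
have L_plimit : L \in plimit_pred.
  rewrite inE; apply/periodic_limitP; split=> [s||t].
  - apply: (uniform_limit_cvg (nbhs_filter s)) => e e0.
    have [X XL] := filter_ex (unifL _ e0); have [cX _ _] := plimitP X.
    by exists X, (X s); split; [exact: cX|exact: XL|exact: XL].
  - have [X XL] := filter_ex (unifL _ ltr01).
    exists (plimit_norm X + 1) => t.
    rewrite -[L t](subrK (X t)) addrC (le_trans (ler_normD _ _))// lerD//.
      exact: le_plimit_norm.
    by rewrite distrC.
  (* The shifted values of [L] eventually lie within [2 * e / 3] of the limit [y] found for [X]. As
     [y] changes with [e], this shows the Cauchy property, and completeness of L2 gives the
     limit. *)
  - apply: cauchy_cvg; apply: cauchy_exP => e e0.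
    have e3 : 0 < e / 3 by rewrite divr_gt0.
    have [X XL] := filter_ex (unifL _ e3).
    have [_ _ /(_ t) /cvg_ex[y Xy]] := plimitP X.
    exists y; apply: filterS ((cvgrPdist_le _ _).1 Xy _ e3) => n Xyn.
    rewrite -ball_normE /ball_/=.
    rewrite (le_lt_trans (ler_distD _ _ _) (le_lt_trans (lerD Xyn (XL _)) _))//.
    by lra.
apply/cvg_ex; exists (MkPlimit L_plimit); apply/cvgrPdist_le => e e0.
apply: filterS (unifL _ e0) => X XL.
by apply/plimit_norm_le => t; rewrite distrC; exact: XL.
Qed.

HB.instance Definition _ := Uniform_isComplete.Build plimit plimit_complete.

End PeriodicLimitSpace.

Theorem theorem2p1 (d : measure_display) (T : measurableType d) (R : realType)
  (P : probability T R) (H : completeNormedModType R)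
  (hH : is_hilbert H) (sH : separable H) (omega : {posnum R}) :
  is_banach (periodic_limit P H omega) (sup_norm P H).
Proof.
pose val_fun : plimit P H omega -> process P H := val.
exists (plimit P H omega : completeNormedModType R), val_fun.
split=> [|| X].
- exact: val_inj.
- apply/seteqP; split=> [_ [X _ <-]|X pX].
    by have /set_mem := plimit_valP X.
  by exists (MkPlimit (mem_set pX)).
- exact: sup_norm_plimit.
Qed.
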